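(* For real numbers $a<b$, let $U_{a,b}$ denote a random variable uniformly distributed on the interval $[a,b]$. Then for every real $y>0$, $$\inf_{a,b\in\mathbb{R},\ a<b}\mathbf{P}\left(|U_{a,b}-\mathbf{E}[U_{a,b}]|\ge y\sqrt{\mathrm{Var}(U_{a,b})}\right)=\begin{cases}1-\dfrac{y}{\sqrt{3}}, & \text{if } 0<y<\sqrt{3},\\[4pt] 0, & \text{if } y\ge\sqrt{3}.\end{cases}$$
   Context: $\mathbf{P}$, $\mathbf{E}$ and $\mathrm{Var}$ denote probability, expectation and variance. *)

(* Defs.v *)
From HB Require Import structures.
From mathcomp Require Import all_boot all_order all_algebra.
From mathcomp Require Import all_classical all_reals all_analysis.
Set Implicit Arguments.
Unset Strict Implicit.
Unset Printing Implicit Defensive.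
Import Order.TTheory GRing.Theory Num.Theory.
Import numFieldNormedType.Exports.
Local Open Scope classical_set_scope.
Local Open Scope ring_scope.

(* The laws are compared on measurable sets only: a measure is a function on
   all sets whose values outside the sigma-algebra are unconstrained. *)
Definition uniformly_distributed d (T : measurableType d) (R : realType)
    (P : probability T R) (X : {RV P >-> R}) (a b : R) (ab : a < b) : Prop :=
  forall A : set R, measurable A -> distribution P X A = uniform_prob ab A.

(* Main.v *)
Require Import Defs.
From HB Require Import structures.
From mathcomp Require Import all_boot all_order all_algebra.
From mathcomp Require Import all_classical all_reals all_analysis.
From mathcomp Require Import measurable_realfun ring lra.
Import Order.TTheory GRing.Theory Num.Theory.
Import numFieldNormedType.Exports.
Local Open Scope classical_set_scope.
Local Open Scope ring_scope.

(** A uniform variable on [[a, b]] has mean [m = (a + b) / 2] and standard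
    deviation [s = (b - a) / (2 sqrt 3)] ([expectation_uniform],
    [variance_uniform]).  The event [|U - m| < r] is an interval of length [2 r]
    centred in [[a, b]], so its probability is [min (2 r / (b - a)) 1]
    ([uniform_prob_centered]).  At [r = y s] the ratio [2 r / (b - a)] equals
    [y / sqrt 3], in which [a] and [b] have cancelled: this is the invariance of
    the standardised uniform law under affine maps.  The complementary event
    thus has the same probability [1 - min (y / sqrt 3) 1] for every pair
    [a < b], and the infimum is taken over a set with a single element.

    Both moments come from one formula, [expectation_uniform_poly]: the mean of
    [p'(U)] is the slope [(p b - p a) / (b - a)] of the chord of [p].  The mean
    is the case [p = x^2 / 2], the variance the case [p = (x - m)^3 / 3]. *)

Lemma integral_deriv_poly {R : realType} {a b : R} (ab : a < b) (p : {poly R}) :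
  (\int[lebesgue_measure]_(x in `[a, b]) (p^`().[x])%:E
   = (p.[b] - p.[a])%:E)%E.
Proof.
rewrite (@continuous_FTC2 _ _ (horner p)) //.
- exact/continuous_subspaceT/continuous_horner.
- split=> [x _||].
  + exact: derivable_horner.
  + exact/cvg_at_right_filter/continuous_horner.
  + exact/cvg_at_left_filter/continuous_horner.
- by move=> x _; rewrite derivE.
Qed.

(** Reduces to nonnegative integrands by splitting [f] into its positive and
    negative parts.  Continuity makes [f] integrable on the compact [[a, b]],
    which is what allows the factor [(b - a)^-1] to be distributed over the
    difference of the two integrals. *)
Lemma integral_uniform_continuous {R : realType} {a b : R} (ab : a < b)
    (f : R -> R) : continuous f ->
  (\int[uniform_prob ab]_x (f x)%:E
   = (b - a)^-1%:E * \int[lebesgue_measure]_(x in `[a, b]) (f x)%:E)%E.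
Proof.
move=> cf.
have mf : measurable_fun [set: R] (EFin \o f).
  by apply/measurable_EFinP; apply: continuous_measurable_fun.
have intf : lebesgue_measure.-integrable `[a, b] (fun x => (f x)%:E).
  apply: continuous_compact_integrable; first exact: segment_compact.
  exact: continuous_subspaceT.
rewrite [X in (_ * X)%E]integralE muleBr//; last first.
  by apply: fin_num_adde_defr; exact: integrable_pos_fin_num.
rewrite [LHS]integralE; congr (_ - _)%E; apply: integral_uniform => //.
- exact: measurable_funepos.
- exact: measurable_funeneg.
Qed.

(** Moments are parametrised by a primitive [p] of the integrand, so that
    transport of the expectation to the law of [X] and the fundamental theorem of
    calculus give a closed form at once. *)
Lemma expectation_uniform_poly {R : realType} {d : measure_display}
    {T : measurableType d} {P : probability T R} {X : {RV P >-> R}} {a b : R}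
    {ab : a < b} (hX : uniformly_distributed X ab) (p : {poly R}) :
  ('E_P[(fun w => p^`().[X w])] = ((p.[b] - p.[a]) / (b - a))%:E)%E.
Proof.
rewrite unlock.
have mp : measurable_fun [set: measurableTypeR R] (EFin \o horner p^`()).
  apply/measurable_EFinP; apply: continuous_measurable_fun.
  exact: continuous_horner.
(* [R] and [measurableTypeR R] carry the same sigma-algebra under different
   displays; [Y] is [X] with the codomain on which [uniform_prob] is a measure,
   so that the two measures can be compared. *)
have mX : measurable_fun [set: T] (X : T -> measurableTypeR R).
  exact: (measurable_funPT X).
pose Y : {mfun T >-> measurableTypeR R} :=
  @mfun_Sub _ _ T (measurableTypeR R) X (mem_set mX).
transitivity (\int[distribution P Y]_x (p^`().[x])%:E)%E.
  rewrite [LHS]integralE [RHS]integralE !ge0_integral_distribution//.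
  - by rewrite -funepos_comp -funeneg_comp.
  - exact: measurable_funeneg.
  - exact: measurable_funepos.
transitivity (\int[uniform_prob ab]_x (p^`().[x])%:E)%E.
  by apply: eq_measure_integral => A mA _; exact: hX.
rewrite integral_uniform_continuous; last exact: continuous_horner.
by rewrite integral_deriv_poly// -EFinM mulrC.
Qed.

Lemma expectation_uniform {R : realType} {d : measure_display}
    {T : measurableType d} {P : probability T R} {X : {RV P >-> R}} {a b : R}
    {ab : a < b} (hX : uniformly_distributed X ab) :
  ('E_P[X] = ((a + b) / 2)%:E)%E.
Proof.
have ba0 : b - a != 0 by rewrite subr_eq0 gt_eqF.
have := expectation_uniform_poly hX (2^-1 *: 'X^2).
have -> : (fun w => (2^-1 *: 'X^2 : {poly R})^`().[X w]) = X.
  apply/funext => w.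
  by rewrite derivZ derivXn hornerZ hornerMn hornerXn; field.
by move=> ->; rewrite !hornerZ !hornerXn; congr EFin; field.
Qed.

Lemma variance_uniform {R : realType} {d : measure_display}
    {T : measurableType d} {P : probability T R} {X : {RV P >-> R}} {a b : R}
    {ab : a < b} (hX : uniformly_distributed X ab) :
  ('V_P[X] = ((b - a) ^+ 2 / 12)%:E)%E.
Proof.
have ba0 : b - a != 0 by rewrite subr_eq0 gt_eqF.
set m := (a + b) / 2.
rewrite /variance unlock (expectation_uniform hX) /= -/m.
have := expectation_uniform_poly hX (3^-1 *: ('X - m%:P) ^+ 3).
have -> : (fun w => (3^-1 *: ('X - m%:P) ^+ 3 : {poly R})^`().[X w])
    = ((X \- cst m) * (X \- cst m))%R.
  apply/funext => w.
  rewrite derivZ deriv_exp derivXsubC mul1r hornerZ hornerMn horner_exp.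
  by rewrite hornerXsubC !fctE/=; field.
move=> ->; rewrite !hornerZ !horner_exp !hornerXsubC /m.
by congr EFin; field.
Qed.

(** The minimum records whether the interval of radius [r] around the midpoint
    lies inside [[a, b]], and then has length [2 r], or covers it entirely. *)
Lemma uniform_prob_centered {R : realType} {a b : R} (ab : a < b) (r : R) :
  0 <= r ->
  uniform_prob ab [set x | `|x - (a + b) / 2| < r]
  = (Num.min (2 * r / (b - a)) 1)%:E.
Proof.
move=> r0.
have ba0 : 0 < b - a by rewrite subr_gt0.
have [rs|rs] := leP r ((b - a) / 2).
- have -> : [set x | `|x - (a + b) / 2| < r]
      = `](a + b) / 2 - r, (a + b) / 2 + r[%classic.
    by apply/seteqP; split=> x /=; rewrite in_itv/= ltr_distl.
  rewrite /uniform_prob (eq_integral (fun=> (b - a)^-1%:E)); last first.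
    move=> x; rewrite inE/= in_itv/= /uniform_pdf => /andP[h1 h2].
    by rewrite ifT//; apply/andP; split; lra.
  rewrite integral_cst//= lebesgue_measure_itv/= lte_fin.
  rewrite min_l; last by rewrite ler_pdivrMr//; lra.
  (* The length formula for an interval separates out the empty case [r = 0]. *)
  case: ifPn => [_|].
    by rewrite -EFinD -EFinM; congr EFin; field; rewrite gt_eqF.
  rewrite -leNgt => rle.
  have -> : r = 0 by lra.
  by rewrite mule0 mulr0 mul0r.
- rewrite /uniform_prob (integral_uniform_pdf1 ab).
    by rewrite min_r// ler_pdivlMr//; lra.
  move=> x /=; rewrite in_itv/= ltr_distl => /andP[h1 h2].
  by apply/andP; split; lra.
Qed.

Theorem proposition2p1 (R : realType)
    (d : R -> R -> measure_display)
    (T : forall a b : R, measurableType (d a b))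
    (P : forall a b : R, probability (T a b) R)
    (U : forall a b : R, {RV (P a b) >-> R})
    (hU : forall (a b : R) (ab : a < b), uniformly_distributed (U a b) ab)
    (y : R) (hy : 0 < y) :
  ereal_inf [set P ab.1 ab.2
      [set w | (y%:E * sqrte 'V_(P ab.1 ab.2)[U ab.1 ab.2] <=
                `|(U ab.1 ab.2 w)%:E - 'E_(P ab.1 ab.2)[U ab.1 ab.2]|)%E]
    | ab in [set ab : R * R | ab.1 < ab.2]]
  = if y < Num.sqrt 3 then (1 - y / Num.sqrt 3)%:E else 0%:E.
Proof.
set c := (if _ then _ else _).
suff tail a b : a < b ->
    P a b [set w | (y%:E * sqrte 'V_(P a b)[U a b] <=
                `|(U a b w)%:E - 'E_(P a b)[U a b]|)%E] = c.
  rewrite -[RHS]ereal_inf1; congr ereal_inf; apply/seteqP; split.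
    by move=> _ [[a b] /= ab <-]; exact: tail.
  by move=> _ ->; exists (0, 1); [exact: ltr01|apply: tail; exact: ltr01].
move=> ab; have hX := hU a b ab.
have s3 : 0 < Num.sqrt 3 :> R by rewrite sqrtr_gt0.
have ba0 : 0 < b - a by rewrite subr_gt0.
rewrite (expectation_uniform hX) (variance_uniform hX) /=.
have -> : Num.sqrt ((b - a) ^+ 2 / 12) = (b - a) / (2 * Num.sqrt 3).
  rewrite -[RHS]ger0_norm ?divr_ge0 ?mulr_ge0 ?ltW// -sqrtr_sqr.
  congr Num.sqrt; rewrite expr_div_n exprMn sqr_sqrtr//.
  by congr (_ / _); ring.
set r := y * ((b - a) / (2 * Num.sqrt 3)).
pose I : set R := [set x | `|x - (a + b) / 2| < r].
have mI : measurable I.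
  rewrite (_ : I = `](a + b) / 2 - r, (a + b) / 2 + r[%classic)//.
  by apply/seteqP; split=> x; rewrite /I/= in_itv/= ltr_distl.
have -> : [set w | (y%:E * ((b - a) / (2 * Num.sqrt 3))%:E
      <= `|(U a b w)%:E - ((a + b) / 2)%:E|)%E] = U a b @^-1` (~` I).
  apply/seteqP; split=> w; rewrite /I /preimage/= -EFinM lee_fin leNgt.
    by move/negP.
  by move=> /negP.
transitivity (distribution (P a b) (U a b) (~` I)); first by [].
rewrite hX; last exact: measurableC.
transitivity (1 - uniform_prob ab I)%E; first exact: probability_setC.
rewrite uniform_prob_centered; last by rewrite !mulr_ge0 ?invr_ge0 ?mulr_ge0 ?ltW.
have -> : 2 * r / (b - a) = y / Num.sqrt 3.
  by rewrite /r; field; rewrite !gt_eqF.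
rewrite /c -EFinB; case: ifPn => [ys|]; last rewrite -leNgt => ys.
  by rewrite min_l// ler_pdivrMr// mul1r ltW.
by rewrite min_r ?subrr// ler_pdivlMr// mul1r.
Qed.
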